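(* Let $\xi_1,\ldots,\xi_n$ be independent real-valued random variables with finite moments of all positive orders, and let $m_{i,2k}=\mathbf{E}[\xi_i^{2k}]$, $i=1,\ldots,n$, $k=1,2,\ldots$. Suppose that the growth rates $r_1,\ldots,r_n$ of the even order moments satisfy $$\frac{m_{1,2(k+1)}}{m_{1,2k}}=\mathcal{O}((k+1)^{r_1}),\ \ldots,\ \frac{m_{n,2(k+1)}}{m_{n,2k}}=\mathcal{O}((k+1)^{r_n})\quad\text{as } k\to\infty.$$ If the rates $r_1,\ldots,r_n$ are such that $r_1+\cdots+r_n\le 2$, then the product $Z_n=\xi_1\cdots\xi_n$ is M-det.
   Context: A random variable $X$ with distribution function $F$ and moments $m_k=\mathbf{E}[X^k]$ (all finite) is called moment determinate (M-det) if $F$ is the only distribution having the moment sequence $\{m_k\}_{k=1}^\infty$. *)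

(* Defs.v *)
From HB Require Import structures.
From mathcomp Require Import all_boot all_order all_algebra.
From mathcomp Require Import all_classical all_reals all_analysis.

Set Implicit Arguments.
Unset Strict Implicit.
Unset Printing Implicit Defensive.

Import Order.TTheory GRing.Theory Num.Theory.
Import numFieldNormedType.Exports.

Local Open Scope classical_set_scope.
Local Open Scope ring_scope.

Section moments.
Context d (T : measurableType d) (R : realType) (P : probability T R).

Definition mutually_independent (I : finType) (X : I -> {RV P >-> R}) : Prop :=
  forall (J : {set I}) (A : I -> set R), (forall i, measurable (A i)) ->
    P (\bigcap_(i in [set` J]) X i @^-1` A i) =
    (\prod_(i in J) P (X i @^-1` A i))%E.

Definition finite_moments (X : T -> R) : Prop :=
  forall k, (0 < k)%N -> P.-integrable [set: T] (fun t => (X t ^+ k)%:E).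

(* Meaningful only under [finite_moments X], since [fine] sends +oo to 0. *)
Definition moment (X : T -> R) (k : nat) : R :=
  fine 'E_P[fun t => X t ^+ k].

End moments.

(* [X] is not required to be measurable, because [finite_moments P X] at k = 1
   already implies it.  The distribution of [X] is A |-> P (X @^-1` A); the
   competing distributions are the Borel probability measures [nu] on the line,
   whose moments are those of the identity function under [nu]. *)
Definition moment_determinate d (T : measurableType d) (R : realType)
    (P : probability T R) (X : T -> R) : Prop :=
  finite_moments P X /\
  forall nu : probability (measurableTypeR R) R,
    finite_moments nu id ->
    (forall k, (0 < k)%N -> moment nu id k = moment P X k) ->
    forall A : set R, measurable A -> nu A = P (X @^-1` A).

(* Main.v *)
Require Import Defs.
From HB Require Import structures.
From mathcomp Require Import all_boot all_order all_algebra.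
From mathcomp Require Import all_classical all_reals all_analysis.
From mathcomp Require Import measurable_realfun zify ring lra.

(** The hypothesis bounds the even moments m_2k of Z = xi_1 ... xi_n so well
    that E[exp(rho |Z|)] is finite for some rho > 0, and a law with an
    exponential moment is determined by its moments.

    Moments.  By independence m_2k is the product of the m_{i,2k}
    ([expectation_prod]), so m_2(k+1) / m_2k is eventually at most
    C (k+1)^(r_1 + ... + r_n) <= C (k+1)^2.  As (2k+2)(2k+1) >= (k+1)^2, this
    gives m_2k <= A D^2k (2k)! ([factorial_bound_of_ratio]), and summing the
    power series of exp(rho x) + exp(-rho x), which contains even powers only,
    gives the exponential moment ([integrable_expR_even_moments]).  Only the
    moments enter, so every competing law has the exponential moment too.

    Uniqueness ([probability_determined_by_moments]).  Let mu and nu have the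
    same moments and an exponential moment.  Consider the bounded functions f
    with int f x^k dmu = int f x^k dnu for all k, and call m a multiplier when
    f m is such a function whenever f is.  Multipliers visibly form an algebra.
    For small h, sin (h x) and cos (h x) are multipliers, because their Taylor
    expansions converge in a dominated way when integrated against f x^k
    ([multiplier_entire]).  Hence every polynomial in sin (h (x - a)) is a
    multiplier and, the constant 1 being one of the functions f, has the same
    integral under mu and nu.
    The polynomials 1 - (1 - y^n)^(n 2^n) tend on [0, 1] to the indicator of
    y >= 1/2 ([cvg_threshold]); at y = (1 + sin (h (x - a))) / 2 they isolate
    the set where sin (h (x - a)) >= 0, which as h tends to 0 becomes the
    half-line x >= a.  So mu and nu agree on half-lines.  No characteristic
    function and no analytic continuation is involved: the algebra contains
    all high powers of sin (h (x - a)) although h itself stays small. *)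

Set Implicit Arguments.
Unset Strict Implicit.
Unset Printing Implicit Defensive.

Import Order.TTheory GRing.Theory Num.Theory.
Import numFieldNormedType.Exports.

Local Open Scope classical_set_scope.
Local Open Scope ring_scope.

(** * Partial sums dominated by the exponential *)

Section power_series_bounds.
Context {R : realType}.
Implicit Types (x y : R) (c : R^nat).

Lemma expR_ge_expn y k : 0 <= y -> y ^+ k <= k`!%:R * expR y.
Proof.
move=> y0; case: k => [|k].
  by rewrite expr0 mul1r -expR0 ler_expR.
rewrite mulrC -ler_pdivrMr ?ltr0n ?fact_gt0//.
by apply: le_trans (expR_ge1Dxn k y0); rewrite lerDr.
Qed.

Lemma series_exp_coeff_le y n : 0 <= y -> series (exp_coeff y) n <= expR y.
Proof.
move=> y0; apply: nondecreasing_cvgn_le; last exact: is_cvg_series_exp_coeff.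
by apply: nondecreasing_series => k _ _; exact: exp_coeff_ge0.
Qed.

Lemma norm_series_le_expR c y n : (forall j, `|c j| <= (j`!%:R)^-1) ->
  `|\sum_(0 <= j < n) c j * y ^+ j| <= expR `|y|.
Proof.
move=> cle; apply: le_trans (series_exp_coeff_le n (normr_ge0 y)).
apply: le_trans (ler_norm_sum _ _ _) _.
apply: ler_sum => j _; rewrite normrM normrX /exp_coeff /= mulrC.
by rewrite ler_wpM2l// exprn_ge0.
Qed.
End power_series_bounds.

(** * Functions that cannot tell two laws with equal moments apart *)

Section moment_equivalence.
Context {R : realType} (mu nu : probability (measurableTypeR R) R).

(** Integrability is part of the notion, so that it is stable under linear
    combinations and dominated limits without side conditions. *)
Definition agree (f : R -> R) : Prop :=
  [/\ mu.-integrable [set: R] (EFin \o f), nu.-integrable [set: R] (EFin \o f)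
    & (\int[mu]_x (f x)%:E = \int[nu]_x (f x)%:E)%E].

Lemma agreeD f g : agree f -> agree g -> agree (f \+ g).
Proof.
move=> [f1 f2 fE] [g1 g2 gE]; split.
- exact: (integrableD measurableT f1 g1).
- exact: (integrableD measurableT f2 g2).
- by rewrite !integralD_EFin// fE gE.
Qed.

Lemma agreeZ c f : agree f -> agree (fun x => c * f x).
Proof.
move=> [f1 f2 fE]; split.
- exact: (integrableZl measurableT c f1).
- exact: (integrableZl measurableT c f2).
- have := integralZl measurableT f1 c; have := integralZl measurableT f2 c.
  by rewrite /= => e1 e2; rewrite e1 e2 fE.
Qed.

Lemma eq_agree f g : f =1 g -> agree f -> agree g.
Proof. by move=> /funext ->. Qed.

Lemma agree0 : agree (fun=> 0).
Proof.
split; [exact: integrable0|exact: integrable0|by rewrite !integral0].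
Qed.

Lemma agree_sum n (F : nat -> R -> R) : (forall j, agree (F j)) ->
  agree (fun x => \sum_(0 <= j < n) F j x).
Proof.
move=> aF; elim: n => [|n ih].
  by apply: eq_agree agree0 => x; rewrite big_geq.
apply: eq_agree (agreeD ih (aF n)) => x /=.
by rewrite big_nat_recr.
Qed.

Lemma agree_dominated (F : nat -> R -> R) (f g : R -> R) :
  mu.-integrable [set: R] (EFin \o g) -> nu.-integrable [set: R] (EFin \o g) ->
  (forall n x, `|F n x| <= g x) ->
  (forall x, F n x @[n --> \oo] --> f x) ->
  (forall n, agree (F n)) -> agree f.
Proof.
move=> g1 g2 Fg Ff aF.
have mF n : measurable_fun [set: R] (EFin \o F n).
  by have [aFn _ _] := aF n; exact: (measurable_int mu aFn).
have mf : measurable_fun [set: R] (EFin \o f).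
  apply: (emeasurable_fun_cvg _ _ mF) => x _; apply: cvg_EFin; last exact: Ff.
  by apply: nearW.
have dct (m : probability (measurableTypeR R) R) :
    m.-integrable [set: R] (EFin \o g) ->
    m.-integrable [set: R] (EFin \o f) /\
    (\int[m]_x (F n x)%:E @[n --> \oo] --> \int[m]_x (f x)%:E)%E.
  move=> mg.
  have [] := @dominated_convergence _ _ _ m _ measurableT
     (fun n => EFin \o F n) (EFin \o f) (EFin \o g) mF mf.
  - apply: aeW => x _; apply: cvg_EFin; last exact: Ff.
    by apply: nearW.
  - exact: mg.
  - by apply: aeW => x n _; rewrite /= lee_fin.
  - by [].
have [f1 c1] := dct mu g1; have [f2 c2] := dct nu g2.
split=> //; apply: (cvg_unique _ c1).
- exact: ereal_hausdorff.
- move: c2; rewrite (_ : (fun n => _) = (fun n => \int[mu]_x (F n x)%:E)%E)//.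
  by apply/funext => n; have [_ _ ->] := aF n.
Qed.

Lemma agree_bounded (F : nat -> R -> R) (f : R -> R) C :
  (forall n x, `|F n x| <= C) ->
  (forall x, F n x @[n --> \oo] --> f x) ->
  (forall n, agree (F n)) -> agree f.
Proof.
by apply: agree_dominated; apply: finite_measure_integrable_cst.
Qed.

(** Monomials are enough to test against: by linearity such an f is paired alike
    with all polynomials, hence with the partial sums of a power series. *)
Definition poly_agree (f : R -> R) : Prop :=
  (exists C, forall x, `|f x| <= C) /\ forall k, agree (fun x => f x * x ^+ k).

(** Passing from the functions [f] to their multipliers turns a linear space into
    an algebra: a product of multipliers is again a multiplier by composition,
    whereas nothing can be said of the product of two functions [f]. *)
Definition multiplier (m : R -> R) : Prop :=
  forall f, poly_agree f -> poly_agree (fun x => f x * m x).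

Lemma eq_multiplier f g : f =1 g -> multiplier f -> multiplier g.
Proof. by move=> /funext ->. Qed.

Lemma multiplierD m1 m2 :
  multiplier m1 -> multiplier m2 -> multiplier (m1 \+ m2).
Proof.
move=> h1 h2 f af; have [[C1 b1] a1] := h1 _ af; have [[C2 b2] a2] := h2 _ af.
split=> [|k].
- exists (C1 + C2) => x; rewrite mulrDr (le_trans (ler_normD _ _))//.
  exact: lerD.
- by apply: eq_agree (agreeD (a1 k) (a2 k)) => x /=; rewrite mulrDr mulrDl.
Qed.

Lemma multiplierM m1 m2 :
  multiplier m1 -> multiplier m2 -> multiplier (m1 \* m2).
Proof.
move=> h1 h2 f af.
by rewrite (_ : (fun x => _) = (fun x => f x * m1 x * m2 x));
  [exact/h2/h1|apply/funext => x /=; rewrite mulrA].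
Qed.

Lemma multiplier_cst c : multiplier (fun=> c).
Proof.
move=> f [[C b] a]; split=> [|k].
- by exists (C * `|c|) => x; rewrite normrM ler_wpM2r.
- by apply: eq_agree (agreeZ c (a k)) => x; rewrite mulrCA mulrA.
Qed.

Lemma multiplierX m n : multiplier m -> multiplier (fun x => m x ^+ n).
Proof.
move=> hm; elim: n => [|n ih]; first exact: multiplier_cst.
by apply: eq_multiplier (multiplierM hm ih) => x; rewrite /= exprS.
Qed.

Hypothesis agree_expn : forall k, agree (fun x => x ^+ k).

(** Equality of the moments says that the constant 1 belongs to the class on which
    multipliers act. *)
Lemma multiplier_agree m : multiplier m -> agree m.
Proof.
move=> hm; have /hm [_ /(_ 0)] : poly_agree (fun=> 1).
  split; first by exists 1 => x; rewrite normr1.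
  by move=> k; apply: eq_agree (agree_expn k) => x; rewrite mul1r.
by apply: eq_agree => x; rewrite expr0 mulr1 mul1r.
Qed.

Variable rho : R.
Hypothesis rho_gt0 : 0 < rho.
Hypothesis mu_exp : mu.-integrable [set: R] (fun x => (expR (rho * `|x|))%:E).
Hypothesis nu_exp : nu.-integrable [set: R] (fun x => (expR (rho * `|x|))%:E).

(** Integrate the power series of [phi (h x)] term by term against f x^k.  Its
    partial sums are at most exp(h |x|) <= exp(rho |x| / 2), and x^k is at most a
    constant times exp(rho |x| / 2), so exp(rho |x|) dominates; the condition
    [h *+ 2 <= rho] leaves half of the exponential moment to the monomial.  The
    bound on [phi] keeps the product in the class of bounded functions. *)
Lemma multiplier_entire (c : R^nat) (phi : R -> R) (h : R) :
  (forall j, `|c j| <= (j`!%:R)^-1) ->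
  (forall x, (fun n => \sum_(0 <= j < n) c j * x ^+ j) @ \oo --> phi x) ->
  (forall x, `|phi x| <= 1) -> 0 <= h -> h *+ 2 <= rho ->
  multiplier (fun x => phi (h * x)).
Proof.
move=> cle cphi phi1 h0 hrho f [[C fC] af].
have C0 : 0 <= C by apply: le_trans (fC 0).
split=> [|k].
  exists C => x; rewrite normrM (le_trans _ (fC x))//.
  by rewrite ler_piMr.
(* from (rho |x| / 2)^k <= k! exp(rho |x| / 2) *)
pose D := C * (k`!%:R * (2 / rho) ^+ k).
apply: (@agree_dominated
    (fun n x => f x * (\sum_(0 <= j < n) c j * (h * x) ^+ j) * x ^+ k)
    _ (fun x => D * expR (rho * `|x|))).
- exact: (integrableZl measurableT D mu_exp).
- exact: (integrableZl measurableT D nu_exp).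
- move=> n x; rewrite !normrM normrX.
  have -> : expR (rho * `|x|) = expR (rho / 2 * `|x|) * expR (rho / 2 * `|x|).
    by rewrite -expRD; congr expR; field.
  rewrite /D -mulrA -[leRHS]mulrA ler_pM//.
  have e1 : `|\sum_(0 <= j < n) c j * (h * x) ^+ j| <= expR (rho / 2 * `|x|).
    apply: le_trans (norm_series_le_expR _ _ cle) _.
    rewrite ler_expR normrM (ger0_norm h0) ler_wpM2r//.
    by move: hrho; rewrite -mulr_natr; lra.
  have e2 : `|x| ^+ k <= (2 / rho) ^+ k * (k`!%:R * expR (rho / 2 * `|x|)).
    have -> : `|x| ^+ k = (2 / rho) ^+ k * (rho / 2 * `|x|) ^+ k.
      rewrite -exprMn; congr (_ ^+ _); field.
      by rewrite gt_eqF.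
    apply: ler_wpM2l; first by rewrite exprn_ge0// divr_ge0// ltW.
    by apply: expR_ge_expn; rewrite mulr_ge0// divr_ge0// ltW.
  apply: le_trans (ler_pM _ _ e1 e2) _; rewrite ?exprn_ge0//.
  rewrite le_eqVlt; apply/orP; left; apply/eqP; ring.
- move=> x; apply: cvgMl; apply: cvgMr; exact: cphi.
- move=> n.
  apply: eq_agree (@agree_sum n (fun j x => c j * h ^+ j * (f x * x ^+ (j + k))) _).
    move=> x /=; rewrite mulrAC mulrC big_distrl /=.
    by apply: eq_bigr => j _; rewrite exprMn exprD; ring.
  by move=> j; apply: agreeZ.
Qed.

End moment_equivalence.

(** * Polynomials approximating a step function *)

Section threshold_polynomials.
Context {R : realType}.
Implicit Types y u : R.

(** With u = y^n and K = n 2^n, the value of (1 - u)^K is governed by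
    K u = n (2 y)^n.  The factor n in the exponent settles the boundary case
    y = 1/2, where K u = n still tends to infinity. *)
Definition threshold n y : R := 1 - (1 - y ^+ n) ^+ (n * 2 ^ n).

Lemma bernoulli_le1 u k : 0 <= u <= 1 -> (1 - u) ^+ k * (1 + k%:R * u) <= 1.
Proof.
move=> /andP[u0 u1]; elim: k => [|k ih]; first by rewrite expr0; lra.
apply: le_trans ih; rewrite exprSr -mulrA.
apply: ler_wpM2l; first by rewrite exprn_ge0// subr_ge0.
rewrite -natr1; have : 0 <= (k%:R : R) by [].
by move=> ?; nra.
Qed.

Lemma bernoulli_ge u k : 0 <= u <= 1 -> 1 - k%:R * u <= (1 - u) ^+ k.
Proof.
move=> /andP[u0 u1]; elim: k => [|k ih]; first by rewrite expr0; lra.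
rewrite exprS -natr1.
have : (1 - u) * (1 - k%:R * u) <= (1 - u) * (1 - u) ^+ k.
  by apply: ler_wpM2l => //; rewrite subr_ge0.
apply: le_trans; have : 0 <= (k%:R : R) by [].
by move=> ?; nra.
Qed.

(** Some w < 1 has z <= w^2, and n w^n stays bounded by the inequality
    [bernoulli_le1] at u = 1 - w; the other factor w^n tends to 0. *)
Lemma cvg_natM_expr (z : R) : 0 <= z < 1 -> n%:R * z ^+ n @[n --> \oo] --> 0.
Proof.
move=> /andP[z0 z1].
(* z <= w^2 because 4 w^2 - 4 z = (1 - z)^2 *)
pose w := (1 + z) / 2.
have w0 : 0 <= w by rewrite /w; lra.
have w1 : w < 1 by rewrite /w; lra.
have zw : z <= w * w by rewrite /w; nra.
apply: (@squeeze_cvgr _ _ _ _ (fun=> 0) (fun n => (1 - w)^-1 * w ^+ n)).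
- apply: nearW => n; rewrite mulr_ge0 ?exprn_ge0//=.
  have : n%:R * w ^+ n <= (1 - w)^-1.
    rewrite -[leRHS]mul1r ler_pdivlMr ?subr_gt0//.
    have : w ^+ n * (1 + n%:R * (1 - w)) <= 1.
      have := @bernoulli_le1 (1 - w) n; rewrite subKr; apply.
      by apply/andP; split; lra.
    have : 0 <= w ^+ n by rewrite exprn_ge0.
    by move=> *; nra.
  move=> /(ler_wpM2r (exprn_ge0 n w0)); apply: le_trans.
  rewrite -mulrA -exprMn ler_wpM2l//.
  by rewrite lerXn2r ?nnegrE// mulr_ge0.
- exact: cvg_cst.
- rewrite -[X in _ --> X](mulr0 (1 - w)^-1).
  by apply: cvgMr; apply: cvg_expr; rewrite ger0_norm.
Qed.

Lemma threshold_itv n y : 0 <= y <= 1 -> 0 <= threshold n y <= 1.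
Proof.
move=> /andP[y0 y1].
have u0 : 0 <= 1 - y ^+ n by rewrite subr_ge0 exprn_ile1.
have u1 : 1 - y ^+ n <= 1 by rewrite gerBl exprn_ge0.
rewrite /threshold subr_ge0 gerBl exprn_ge0// andbT.
by rewrite exprn_ile1.
Qed.

Lemma cvg_threshold y : 0 <= y <= 1 ->
  threshold n y @[n --> \oo] --> ((2^-1 <= y)%R%:R : R).
Proof.
move=> /andP[y0 y1].
have u01 n : 0 <= y ^+ n <= 1 by rewrite exprn_ge0//= exprn_ile1.
have ku n : (n * 2 ^ n)%:R * y ^+ n = n%:R * (2 * y) ^+ n :> R.
  by rewrite natrM natrX exprMn mulrA.
have t01 n : 0 <= threshold n y <= 1 by apply: threshold_itv; rewrite y0.
case: leP => y2 /=; last first.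
  apply: (@squeeze_cvgr _ _ _ _ (fun=> 0) (fun n => n%:R * (2 * y) ^+ n)).
  - apply: nearW => n; have /andP[-> _] := t01 n; rewrite /threshold /=.
    by have := bernoulli_ge (n * 2 ^ n) (u01 n); rewrite ku; lra.
  - exact: cvg_cst.
  - by apply: cvg_natM_expr; apply/andP; split; lra.
apply: (@squeeze_cvgr _ _ _ _ (fun n => 1 - n.+1%:R^-1) (fun=> 1)).
- apply: nearW => n; have /andP[_ ->] := t01 n; rewrite andbT /threshold lerD2l.
  rewrite lerN2 -[leRHS]mul1r ler_pdivlMr ?ltr0n//.
  apply: le_trans (bernoulli_le1 (n * 2 ^ n) (u01 n)); rewrite ku.
  apply: ler_wpM2l.
    by have /andP[? ?] := u01 n; rewrite exprn_ge0// subr_ge0.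
  rewrite -nat1r lerD2l ler_peMr// exprn_ege1//; lra.
- rewrite -[X in _ --> X]subr0; apply: cvgB; first exact: cvg_cst.
  exact: cvg_harmonic.
- exact: cvg_cst.
Qed.

End threshold_polynomials.

(** * Moments determine a law with an exponential moment *)

Section moment_uniqueness.
Context {R : realType} (mu nu : probability (measurableTypeR R) R).
Hypothesis agree_expn : forall k, agree mu nu (fun x => x ^+ k).
Variable rho : R.
Hypothesis rho_gt0 : 0 < rho.
Hypothesis mu_exp : mu.-integrable [set: R] (fun x => (expR (rho * `|x|))%:E).
Hypothesis nu_exp : nu.-integrable [set: R] (fun x => (expR (rho * `|x|))%:E).

Let multiplier_sin (h : R) : 0 <= h -> h *+ 2 <= rho ->
  multiplier mu nu (fun x => sin (h * x)).
Proof.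
apply: (multiplier_entire rho_gt0 mu_exp nu_exp
  (c := fun n => (odd n)%:R * (-1) ^+ n.-1./2 * (n`!%:R)^-1)).
- move=> j; rewrite !normrM normrX normrN1 expr1n mulr1.
  rewrite [X in _ * X]ger0_norm ?invr_ge0//.
  by case: odd; rewrite ?normr1 ?normr0 ?mul1r// mul0r invr_ge0.
- move=> x; have : series (sin_coeff x) @ \oo --> sin x.
    by rewrite unlock; exact: is_cvg_series_sin_coeff.
  by rewrite sin_coeffE.
- by move=> x; rewrite ler_norml sin_geN1 sin_le1.
Qed.

Let multiplier_cos (h : R) : 0 <= h -> h *+ 2 <= rho ->
  multiplier mu nu (fun x => cos (h * x)).
Proof.
apply: (multiplier_entire rho_gt0 mu_exp nu_exp
  (c := fun n => (~~ odd n)%:R * (-1) ^+ n./2 * (n`!%:R)^-1)).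
- move=> j; rewrite !normrM normrX normrN1 expr1n mulr1.
  rewrite [X in _ * X]ger0_norm ?invr_ge0//.
  by case: odd; rewrite /= ?normr1 ?normr0 ?mul1r// mul0r invr_ge0.
- move=> x; have : series (cos_coeff x) @ \oo --> cos x.
    by rewrite unlock; exact: is_cvg_series_cos_coeff.
  by rewrite cos_coeffE.
- by move=> x; rewrite ler_norml cos_geN1 cos_le1.
Qed.

(** The addition formula moves the origin to [a], so that only expansions at 0 are
    needed. *)
Let multiplier_sinB (h a : R) : 0 <= h -> h *+ 2 <= rho ->
  multiplier mu nu (fun x => sin (h * (x - a))).
Proof.
move=> h0 hrho.
have := (multiplierD
  (multiplierM (multiplier_sin h0 hrho) (multiplier_cst (cos (h * a))))
  (multiplierM (multiplier_cos h0 hrho) (multiplier_cst (- sin (h * a))))).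
apply: eq_multiplier.
by move=> x; rewrite /= mulrBr sinB mulrN.
Qed.

(** The indicator is a bounded pointwise limit of threshold polynomials of the
    multiplier (1 + sin (h (x - a))) / 2, which takes its values in [0, 1] and
    reaches 1/2 exactly where the sine is nonnegative. *)
Let agree_sin_ge0 (h a : R) : 0 <= h -> h *+ 2 <= rho ->
  agree mu nu (fun x => (0 <= sin (h * (x - a)))%R%:R).
Proof.
move=> h0 hrho.
pose g x := (1 + sin (h * (x - a))) / 2.
have g01 x : 0 <= g x <= 1.
  have := sin_geN1 (h * (x - a)); have := sin_le1 (h * (x - a)).
  by rewrite /g => *; apply/andP; split; lra.
have mg : multiplier mu nu g.
  exact: (multiplierM (multiplierD (multiplier_cst 1)
    (multiplier_sinB a h0 hrho)) (multiplier_cst 2^-1)).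
have mpow n k : multiplier mu nu (fun x => (1 - g x ^+ n) ^+ k).
  apply: multiplierX.
  have := multiplierD (multiplier_cst 1)
    (multiplierM (multiplier_cst (-1)) (multiplierX n mg)).
  by apply: eq_multiplier; move=> x /=; rewrite mulN1r.
apply: (@agree_bounded _ _ _ (fun n x => threshold n (g x)) _ 1).
- move=> n x; have /andP[? ?] := threshold_itv n (g01 x).
  by rewrite ger0_norm.
- move=> x; rewrite (_ : (0 <= sin _)%R = (2^-1 <= g x)); last first.
    by rewrite /g; apply/idP/idP => ?; lra.
  exact: cvg_threshold.
- move=> n; apply: (multiplier_agree agree_expn).
  have := multiplierD (multiplier_cst 1)
    (multiplierM (multiplier_cst (-1)) (mpow n (n * 2 ^ n)%N)).
  by apply: eq_multiplier; move=> x /=; rewrite mulN1r.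
Qed.

(** For fixed x, once h |x - a| < pi the sign of sin (h (x - a)) is the sign of
    x - a; a bounded pointwise limit along h = rho / (2 (n + 1)) concludes. *)
Let agree_ge a : agree mu nu (fun x => (a <= x)%R%:R).
Proof.
pose h n : R := rho / 2 / n.+1%:R.
apply: (@agree_bounded _ _ _
  (fun n x => (0 <= sin (h n * (x - a)))%R%:R) _ 1).
- by move=> n x; case: (0 <= sin _); rewrite ?normr1 ?normr0.
- move=> x; apply: cvg_near_cst.
  have h0 : h n * (x - a) @[n --> \oo] --> 0.
    rewrite -[X in _ --> X](mul0r (x - a)); apply: cvgMl.
    rewrite -[X in _ --> X](mulr0 (rho / 2)); apply: cvgMr.
    exact: cvg_harmonic.
  have /cvgr0_norm_lt := h0 => /(_ _ (pi_gt0 R)).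
  apply: filterS => n; rewrite ltr_norml => /andP[l1 l2].
  have hn : 0 < h n by rewrite /h !divr_gt0.
  suff -> : (0 <= sin (h n * (x - a)))%R = (a <= x)%R by [].
  case: (leP a x) => ax.
    by rewrite sin_ge0_pi// (ltW l2) mulr_ge0 ?subr_ge0// ltW.
  apply/negbTE; rewrite -ltNge -oppr_gt0 -sinN sin_gt0_pi//.
  by rewrite oppr_gt0 pmulr_rlt0// subr_lt0 ax /= ltrNl.
- move=> n; apply: agree_sin_ge0; first by rewrite /h !divr_ge0// ltW.
  rewrite /h mulr2n -mulrDl -splitr ler_pdivrMr ?ltr0n//.
  by apply: ler_peMr; rewrite ?ler1n// ltW.
Qed.

(** Half-lines [a, +oo[ are stable under intersection, generate the Borel sets and
    exhaust the line. *)
Lemma probability_determined_by_moments (A : set R) :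
  measurable A -> mu A = nu A.
Proof.
apply: (@measure_unique _ _ (measurableTypeR R) (@RGenCInfty.G R)
  (fun n => `[- n%:R, +oo[%classic) _ _ _ _ mu nu).
- exact: RGenCInfty.measurableE.
- move=> _ _ [x ->] [y ->]; exists (Num.max x y).
  apply/seteqP; split=> z /=; rewrite !in_itv/= !andbT ge_max.
    by move=> [-> ->].
  by move=> /andP[].
- by move=> n; exists (- n%:R).
- apply/seteqP; split=> // x _; exists (Num.bound `|x|) => //=.
  rewrite in_itv/= andbT lerNl ltW//; apply: le_lt_trans (archi_boundP (normr_ge0 x)).
  by rewrite -normrN ler_norm.
- move=> _ [a ->]; have [_ _] := agree_ge a.
  have E (m : probability (measurableTypeR R) R) :
      (\int[m]_x ((a <= x)%R%:R)%:E = m `[a, +oo[%classic)%E.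
    rewrite -[X in m X]setIT -integral_indic//.
    apply: eq_integral => x _; rewrite indicE; 
    by rewrite mem_setE in_itv/= andbT.
  by rewrite !E.
- by move=> n; rewrite (le_lt_trans (probability_le1 _ _)) ?ltry.
Qed.

End moment_uniqueness.

(** * Exponential moments from even moments *)

Section exponential_moment.
Context d (T : measurableType d) {R : realType}.
Variables (m : {measure set T -> \bar R}) (X : T -> R).
Hypothesis mX : measurable_fun [set: T] X.

(** exp(rho |x|) is at most exp(rho x) + exp(-rho x), whose power series has only
    even, nonnegative terms; by monotone convergence it may be integrated term by
    term.  With rho = 1 / (2 D) the integral of the term of degree j is at most
    2 A (rho D)^j = 2 A / 2^j. *)
Lemma integrable_expR_even_moments (A D : R) : 0 < D ->
  (forall k, \int[m]_t (X t ^+ (2 * k))%:E <=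
             (A * D ^+ (2 * k) * (2 * k)`!%:R)%:E)%E ->
  m.-integrable [set: T] (fun t => (expR ((D *+ 2)^-1 * `|X t|))%:E).
Proof.
move=> D0 XA; set rho := (D *+ 2)^-1.
have rho0 : 0 < rho by rewrite invr_gt0 mulrn_wgt0.
have A0 : 0 <= A.
  have : (0 <= (A * D ^+ (2 * 0) * (2 * 0)`!%:R)%:E)%E.
    apply: le_trans (XA 0); apply: integral_ge0 => t _.
    by rewrite lee_fin muln0 expr0.
  by rewrite lee_fin muln0 expr0 !mulr1.
pose c j t := exp_coeff (rho * X t) j + exp_coeff (- (rho * X t)) j.
have c_odd j t : odd j -> c j t = 0.
  move=> oj; rewrite /c /exp_coeff/= exprNn -signr_odd oj expr1 mulN1r mulNr.
  by rewrite subrr.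
have c_even k t : c (2 * k)%N t =
    2 * rho ^+ (2 * k) / (2 * k)`!%:R * X t ^+ (2 * k).
  rewrite /c /exp_coeff/= exprNn -signr_odd oddM/= expr0 mul1r exprMn.
  by ring.
have c_ge0 j t : 0 <= c j t.
  have [oj|ej] := boolP (odd j); first by rewrite c_odd.
  rewrite -(odd_double_half j) (negbTE ej) add0n -mul2n c_even.
  apply: mulr_ge0; last by rewrite exprn_even_ge0// oddM.
  by rewrite divr_ge0// mulr_ge0// exprn_ge0// ltW.
have mc j : measurable_fun [set: T] (EFin \o c j).
  apply/measurable_EFinP; apply: measurable_funD;
    apply: measurable_funM => //; apply: measurable_funX.
    exact: measurable_funM.
  by apply: measurableT_comp => //; exact: measurable_funM.
have csum t : (\sum_(0 <= j <oo) (c j t)%:E =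
    (expR (rho * X t) + expR (- (rho * X t)))%:E)%E.
  apply/cvg_lim => //.
  rewrite (_ : (fun n => _) = (fun n => (series (exp_coeff (rho * X t)) n +
     series (exp_coeff (- (rho * X t))) n)%:E)); last first.
    by apply/funext => n; rewrite sumEFin /series/= -big_split.
  apply: cvg_EFin; first exact: nearW.
  by apply: cvgD; exact: is_cvg_series_exp_coeff.
(* 4 A / 2^(j + 1) is 2 A / 2^j, in the form of the summable halving series *)
have c_int j : (\int[m]_t (c j t)%:E <= ((4 * A) / 2 ^+ (j + 1))%:E)%E.
  have [oj|ej] := boolP (odd j).
    rewrite integral0_eq; last by move=> t _; rewrite c_odd.
    by rewrite lee_fin divr_ge0 ?exprn_ge0// mulr_ge0.
  rewrite -(odd_double_half j) (negbTE ej) add0n -mul2n.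
  set k := j./2.
  under eq_integral do rewrite c_even EFinM.
  have q0 : 0 <= 2 * rho ^+ (2 * k) / (2 * k)`!%:R.
    by rewrite divr_ge0// mulr_ge0// exprn_ge0// ltW.
  rewrite ge0_integralZl//; last 2 first.
  - by apply/measurable_EFinP; exact: measurable_funX.
  - by move=> t _; rewrite lee_fin exprn_even_ge0// oddM.
  have q0E : (0 <= (2 * rho ^+ (2 * k) / (2 * k)`!%:R)%:E)%E by rewrite lee_fin.
  have XAk := lee_wpmul2l q0E (XA k).
  apply: le_trans XAk _.
  have rhoD : rho ^+ (2 * k) * D ^+ (2 * k) = (2 ^+ (2 * k))^-1.
    rewrite -exprMn -exprVn; congr (_ ^+ _).
    by rewrite /rho -mulr_natr; field; rewrite gt_eqF.
  rewrite -EFinM lee_fin exprD expr1 invfM.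
  rewrite [leRHS](_ : _ = 2 * A * (2 ^+ (2 * k))^-1); last by field.
  rewrite -rhoD le_eqVlt; apply/orP; left; apply/eqP.
  by field; rewrite pnatr_eq0 -lt0n fact_gt0.
have mexp : measurable_fun [set: T]
    (fun t => (expR (rho * X t) + expR (- (rho * X t)))%:E).
  apply/measurable_EFinP; apply: measurable_funD;
    apply: measurableT_comp => //.
    exact: measurable_funM.
  by apply: measurableT_comp => //; exact: measurable_funM.
apply: (@le_integrable _ _ _ m _ measurableT _
   (fun t => (expR (rho * X t) + expR (- (rho * X t)))%:E)).
- apply/measurable_EFinP; apply: measurableT_comp => //.
  by apply: measurable_funM => //; exact: measurableT_comp.
- move=> t _; rewrite !gee0_abs ?lee_fin ?expR_ge0 ?addr_ge0 ?expR_ge0//.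
  have [X0|X0] := leP 0 (X t).
    by rewrite ger0_norm// lerDl expR_ge0.
  by rewrite ltr0_norm// mulrN lerDr expR_ge0.
apply/integrableP; split => //.
under eq_integral => t _.
  rewrite gee0_abs ?lee_fin ?addr_ge0 ?expR_ge0// -csum.
  over.
rewrite integral_nneseries//; last by move=> *; rewrite lee_fin.
apply: (@le_lt_trans _ _ (\sum_(0 <= j <oo) ((4 * A) / 2 ^+ (j + 1))%:E)%E).
  by apply: lee_nneseries => [j _ _|j _]; [apply: integral_ge0 => t _; rewrite lee_fin|].
rewrite (_ : limn _ = (4 * A)%:E) ?ltry//.
apply/cvg_lim => //.
rewrite (_ : (fun n => _) =
  (fun n => (series (fun j => (4 * A) / 2 ^+ (j + 1)) n)%:E)); last first.
  by apply/funext => n; rewrite sumEFin.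
apply: cvg_EFin; first exact: nearW.
have := @cvg_geometric_series_half R (4 * A) 0; rewrite expr0 divr1.
by under eq_fun do rewrite natrX.
Qed.
End exponential_moment.

(** * Growth of sequences with quadratic ratios *)

Section factorial_growth.
Context {R : realType}.

(** Passing from k to k + 1 multiplies (2k)! by (2k+2)(2k+1) >= (k+1)^2 and D^2k by
    D^2 >= C.  The constant [A], the sum of the first terms, absorbs the indices
    at which the ratio is not controlled. *)
Lemma factorial_bound_of_ratio (a : nat -> R) (C : R) (N : nat) :
  (forall k, 0 <= a k) ->
  (forall k, (N <= k)%N -> a k.+1 <= C * k.+1%:R ^+ 2 * a k) ->
  exists A D, 0 < D /\ forall k, a k <= A * D ^+ (2 * k) * (2 * k)`!%:R.
Proof.
move=> a0 aC; pose D := 1 + `|C|; pose A := \sum_(i < N.+1) a i.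
have D1 : 1 <= D by rewrite lerDl.
have A0 : 0 <= A by apply: sumr_ge0.
exists A, D; split; first exact: lt_le_trans D1.
have small k : (k <= N)%N -> a k <= A * D ^+ (2 * k) * (2 * k)`!%:R.
  move=> kN; have -> : a k = a (Ordinal (kN : (k < N.+1)%N)) by [].
  apply: (@le_trans _ _ A).
    by rewrite /A (bigD1 (Ordinal (kN : (k < N.+1)%N)))//= lerDl sumr_ge0.
  rewrite -mulrA ler_peMr//; apply: mulr_ege1; first exact: exprn_ege1.
  by rewrite ler1n fact_gt0.
elim=> [|k ih]; first exact: small.
have [kN|Nk] := leqP k.+1 N; first exact: small.
apply: le_trans (aC k Nk) _.
have CD : C <= D ^+ 2.
  apply: le_trans (ler_norm C) _.
  have : D <= D ^+ 2 by rewrite expr2 ler_peMr// (le_trans _ D1).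
  by apply: le_trans; rewrite /D lerDr.
apply: (@le_trans _ _ (D ^+ 2 * k.+1%:R ^+ 2 * a k)).
  by rewrite ler_wpM2r// ler_wpM2r// exprn_ge0.
apply: (@le_trans _ _
  (D ^+ 2 * k.+1%:R ^+ 2 * (A * D ^+ (2 * k) * (2 * k)`!%:R))).
  by rewrite ler_wpM2l// mulr_ge0// exprn_ge0// (le_trans _ D1).
have -> : (2 * k.+1 = (2 * k).+2)%N by rewrite mulnS.
pose E := D ^+ 2 * (A * D ^+ (2 * k) * (2 * k)`!%:R).
have E0 : 0 <= E by rewrite !mulr_ge0 ?exprn_ge0 ?(le_trans _ D1).
have le2 : k.+1%:R ^+ 2 <= (2 * k).+2%:R * (2 * k).+1%:R :> R.
  by rewrite -natrX -natrM ler_nat; nia.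
rewrite [leLHS](_ : _ = E * k.+1%:R ^+ 2); last by rewrite /E; ring.
rewrite [leRHS](_ : _ = E * ((2 * k).+2%:R * (2 * k).+1%:R)).
  exact: ler_wpM2l.
by rewrite !factS !natrM !exprS /E; ring.
Qed.
End factorial_growth.

(** * Expectation of a product of independent variables *)

Section product_expectation.
Import HBNNSimple.
Context d (T : measurableType d) {R : realType} (P : probability T R).
Local Open Scope ereal_scope.

Lemma integral_indic_comp (X : {RV P >-> R}) (B : set R) : measurable B ->
  \int[P]_t (\1_B (X t) : R)%:E = P (X @^-1` B).
Proof.
move=> mB; have mXB : measurable (X @^-1` B) by exact: measurable_funPTI.
by rewrite -[in RHS](setIT (X @^-1` _)) -integral_indic.
Qed.

(** Standard machine: the identity passes from indicators to simple functions by
    linearity and to nonnegative measurable functions by monotone convergence.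
    Finiteness of [c] makes multiplication by [c] commute with the limit. *)
Lemma integral_mul_of_indic (h : T -> R) (X : {RV P >-> R}) (c : \bar R) :
  measurable_fun [set: T] h -> (forall t, 0 <= h t)%R ->
  c \is a fin_num -> 0 <= c ->
  (forall B : set R, measurable B ->
     \int[P]_t (h t * \1_B (X t))%:E = c * P (X @^-1` B)) ->
  forall f : R -> R, measurable_fun [set: R] f -> (forall x, 0 <= f x)%R ->
  \int[P]_t (h t * f (X t))%:E = c * \int[P]_t (f (X t))%:E.
Proof.
move=> mh h0 cfin c0 hc f mf f0.
have mfE : measurable_fun [set: R] (EFin \o f) by exact/measurable_EFinP.
pose s := nnsfun_approx measurableT mfE.
have s_nd (x : R) (i j : nat) : (i <= j)%N -> (s i x <= s j x)%R.
  by move=> ij; have /lefP := nd_nnsfun_approx measurableT mfE ij; exact.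
have s_cvg (x : R) : (s n x)%:E @[n --> \oo] --> (f x)%:E.
  by apply: cvg_nnsfun_approx => // y _; rewrite lee_fin.
have ms n : measurable_fun [set: T] (fun t => s n (X t)).
  exact: measurableT_comp.
have mB n y : measurable (s n @^-1` [set y]) by exact: measurable_sfunP.
have simple (g : T -> R) n : measurable_fun [set: T] g ->
    (forall t, 0 <= g t)%R ->
    \int[P]_t (g t * s n (X t))%:E =
    \sum_(y \in range (s n))
       y%:E * \int[P]_t (g t * \1_(s n @^-1` [set y]) (X t))%:E.
  move=> mg g0.
  have m1 y : measurable_fun [set: T] (fun t => \1_(s n @^-1` [set y]) (X t) : R).
    exact: measurableT_comp.
  have ge0 y t : 0 <= (g t)%:E * (y * \1_(s n @^-1` [set y]) (X t))%:E.
    apply: mule_ge0; first by rewrite lee_fin.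
    by rewrite EFinM; exact: nnfun_muleindic_ge0.
  transitivity (\int[P]_t \sum_(y \in range (s n))
      ((g t)%:E * (y * \1_(s n @^-1` [set y]) (X t))%:E)).
    apply: eq_integral => t _; rewrite [in LHS](fimfunE (s n)) EFinM -fsumEFin//.
    rewrite ge0_mule_fsumr// => y.
    by rewrite EFinM; exact: nnfun_muleindic_ge0.
  rewrite ge0_integral_fsum//; last first.
    move=> y; apply: emeasurable_funM; apply/measurable_EFinP => //.
    exact: measurable_funM.
  apply: eq_fsbigr => y /set_mem [x _ xy].
  rewrite -ge0_integralZl//.
  - by apply: eq_integral => t _; rewrite -!EFinM mulrCA.
  - by apply/measurable_EFinP; exact: measurable_funM.
  - by move=> t _; rewrite lee_fin mulr_ge0.
  - by rewrite lee_fin -xy.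
have mul1I (g : T -> R) :
    \int[P]_t (1 * g t)%:E = \int[P]_t (g t)%:E.
  by under eq_integral do rewrite mul1r.
have simple_c n : \int[P]_t (h t * s n (X t))%:E = c * \int[P]_t (s n (X t))%:E.
  rewrite simple//.
  rewrite -mul1I (simple (fun=> 1%R))//.
  have E1 y : \int[P]_t (1 * \1_(s n @^-1` [set y]) (X t))%:E =
      P (X @^-1` (s n @^-1` [set y])).
    by rewrite mul1I integral_indic_comp.
  under eq_fsbigr do rewrite hc// muleCA.
  under [in RHS]eq_fsbigr do rewrite E1.
  rewrite ge0_mule_fsumr// => y.
  exact: (nnsfun_mulemu_ge0 (distribution P X) (s n)).
have mc (g : T -> R) : measurable_fun [set: T] g -> (forall t, 0 <= g t)%R ->
    \int[P]_t (g t * s n (X t))%:E @[n --> \oo] -->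
    \int[P]_t (g t * f (X t))%:E.
  move=> mg g0; rewrite (_ : (fun t => (g t * f (X t))%:E) =
    (fun t => limn (fun n => (g t * s n (X t))%:E))); last first.
    apply/funext => t; apply/esym/cvg_lim => //.
    under eq_fun do rewrite EFinM.
    by rewrite EFinM; apply: cvgeZl.
  apply: cvg_monotone_convergence => //.
  - by move=> n; apply/measurable_EFinP; exact: measurable_funM.
  - by move=> n t _; rewrite lee_fin mulr_ge0.
  - by move=> t _ i j ij; rewrite lee_fin ler_wpM2l// s_nd.
have lim1 := mc h mh h0.
have lim2 : \int[P]_t (h t * s n (X t))%:E @[n --> \oo] -->
    c * \int[P]_t (f (X t))%:E.
  under eq_fun do rewrite simple_c.
  apply: cvgeZl => //.
  have := mc (fun=> 1%R) (measurable_cst _) (fun=> ler01).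
  rewrite mul1I (_ : (fun n => _) = (fun n => \int[P]_t (s n (X t))%:E))//.
  by apply/funext => n; rewrite mul1I.
apply: (cvg_unique _ lim1 lim2); exact: ereal_hausdorff.
Qed.

(** Independence is the case where every factor is an indicator.  The indicators
    are replaced by the functions [f i] one index at a time, by induction on the
    set [J] of indices already treated: when all factors but the one of index i
    are fixed, [integral_mul_of_indic] applies to that factor. *)
Lemma expectation_prod (I : finType) (X : I -> {RV P >-> R}) (f : I -> R -> R) :
  mutually_independent X ->
  (forall i, measurable_fun [set: R] (f i)) ->
  (forall i x, (0 <= f i x)%R) ->
  (forall i, \int[P]_t (f i (X i t))%:E \is a fin_num) ->
  \int[P]_t (\prod_i f i (X i t))%:E = \prod_i \int[P]_t (f i (X i t))%:E.
Proof.
move=> indep mf f0 ffin.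
pose mixed (A : I -> set R) (J : {set I}) i (x : R) : R :=
  if i \in J then f i x else \1_(A i) x.
have mixed0 A J i x : (0 <= mixed A J i x)%R.
  by rewrite /mixed; case: ifP.
have mmixed A J i : (forall j, measurable (A j)) ->
    measurable_fun [set: T] (fun t => mixed A J i (X i t)).
  move=> mA; rewrite /mixed; case: (i \in J); first exact: measurableT_comp.
  apply: measurableT_comp => //; exact: measurable_indic.
have fin_mixed A J i : (forall j, measurable (A j)) ->
    \int[P]_t (mixed A J i (X i t))%:E \is a fin_num.
  move=> mA; rewrite /mixed; case: (i \in J) => //.
  rewrite integral_indic_comp// fin_num_measure//; exact: measurable_funPTI.
suff H m (J : {set I}) : #|J| = m -> forall A, (forall j, measurable (A j)) ->
    \int[P]_t (\prod_i mixed A J i (X i t))%:E =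
    \prod_i \int[P]_t (mixed A J i (X i t))%:E.
  have := H _ [set: I]%SET erefl (fun=> set0) (fun=> measurable0).
  under eq_integral => t _ do under eq_bigr => i _ do rewrite /mixed inE.
  by under eq_bigr => i _ do under eq_integral => t _ do rewrite /mixed inE.
elim: m J => [|m ih] J.
  move=> /eqP; rewrite cards_eq0 => /eqP -> A mA.
  transitivity (\int[P]_t
      (\1_(\bigcap_(i in [set` [set: I]%SET]) X i @^-1` A i) t : R)%:E).
    apply: eq_integral => t _; congr EFin; rewrite indicE.
    have [/set_mem tA|tA] := boolP (t \in _).
      rewrite big1// => i _; rewrite /mixed inE indicE mem_set//.
      by apply: tA; rewrite /= inE.
    have [i nAi] : exists i, ~ A i (X i t).
      apply/existsNP; apply: contraNnot tA => tA; apply/mem_set => i _.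
      exact: tA.
    by rewrite (bigD1 i)//= /mixed inE indicE memNset// mul0r.
  rewrite integral_indic//; last first.
    by apply: fin_bigcap_measurable => // i _; exact: measurable_funPTI.
  rewrite setIT; apply: etrans (indep [set: I]%SET A mA) _; apply: eq_big => [i|i _]; first by rewrite inE.
  by rewrite -integral_indic_comp//; apply: eq_integral => t _; rewrite /mixed inE.
move=> cJ A mA; have /card_gt0P[i iJ] : (0 < #|J|)%N by rewrite cJ.
rewrite [RHS](bigD1 i)//= [RHS]muleC.
transitivity (\int[P]_t
   ((\prod_(j | j != i) mixed A J j (X j t)) * f i (X i t))%:E).
  apply: eq_integral => t _; rewrite (bigD1 i)//= mulrC.
  by rewrite {2}/mixed iJ.
have -> : \int[P]_t (mixed A J i (X i t))%:E = \int[P]_t (f i (X i t))%:E.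
  by apply: eq_integral => t _; rewrite /mixed iJ.
apply: integral_mul_of_indic => //.
- under eq_fun do rewrite -big_filter.
  by apply: measurable_prod => j _; exact: mmixed.
- by move=> t; apply: prodr_ge0.
- by elim/big_ind: _ => // [x y|j _]; [exact: fin_numM|exact: fin_mixed].
- by elim/big_ind: _ => // [x y|j _]; [exact: mule_ge0|
    apply: integral_ge0 => t _; rewrite lee_fin].
move=> B mB; pose A' j := if j == i then B else A j.
have mA' j : measurable (A' j) by rewrite /A'; case: ifP.
have Emixed j x : j != i -> mixed A J j x = mixed A' (J :\ i)%SET j x.
  by move=> ji; rewrite /mixed /A' !inE ji (negbTE ji).
have EB x : \1_B x = mixed A' (J :\ i)%SET i x.
  by rewrite /mixed /A' !inE eqxx.
have cJi : #|(J :\ i)%SET| = m by move: cJ; rewrite (cardsD1 i) iJ => -[].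
transitivity (\int[P]_t (\prod_j mixed A' (J :\ i)%SET j (X j t))%:E).
  apply: eq_integral => t _; rewrite [in RHS](bigD1 i)//= mulrC EB.
  by congr (_ * _)%:E; apply: eq_bigr => j ji; rewrite Emixed.
rewrite ih// (bigD1 i)//= muleC; congr (_ * _).
  by apply: eq_bigr => j ji; apply: eq_integral => t _; rewrite Emixed.
by rewrite -integral_indic_comp//; apply: eq_integral => t _; rewrite EB.
Qed.

End product_expectation.

(** * From moment growth to determinacy *)

Section even_moments.
Context d (T : measurableType d) {R : realType} (P : probability T R).

Lemma integral_expn_moment (X : T -> R) k : finite_moments P X ->
  (\int[P]_t (X t ^+ k)%:E = (moment P X k)%:E)%E.
Proof.
move=> fX; rewrite /moment unlock.
case: k => [|k]; last first.
  rewrite fineK//; exact: integrable_fin_num (fX _ _).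
rewrite -[LHS]fineK//.
under eq_integral do rewrite expr0.
by rewrite integral_cst//= probability_setT mule1.
Qed.

Lemma moment_even_ge0 (X : T -> R) k : 0 <= moment P X (2 * k).
Proof.
rewrite /moment fine_ge0// unlock integral_ge0// => t _.
by rewrite lee_fin exprn_even_ge0// oddM.
Qed.

Lemma moment0 (X : T -> R) : moment P X 0 = 1.
Proof.
rewrite /moment unlock; under eq_integral do rewrite expr0.
by rewrite integral_cst//= probability_setT mule1.
Qed.

(** A vanishing even moment of positive order means X = 0 almost surely; at k = 0
    the premise fails, since the moment of order 0 is 1. *)
Lemma moment_even_eq0 (X : {RV P >-> R}) k : finite_moments P X ->
  moment P X (2 * k) = 0 -> moment P X (2 * k.+1) = 0.
Proof.
move=> fX; case: k => [|k]; first by rewrite muln0 moment0 => /eqP; rewrite oner_eq0.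
move=> m0.
have mXn j : measurable_fun [set: T] (fun t => (X t ^+ j)%:E).
  by apply/measurable_EFinP; exact: measurable_funX.
have : (\int[P]_t `|(X t ^+ (2 * k.+1))%:E| = 0)%E.
  under eq_integral => t _.
    rewrite gee0_abs; last by rewrite lee_fin exprn_even_ge0// oddM.
    over.
  by rewrite integral_expn_moment// m0.
move/(ae_eq_integral_abs P measurableT (mXn _)) => X0.
rewrite /moment unlock (@ae_eq_integral _ _ _ P _ (cst 0%E))//.
  by rewrite integral0.
apply: filterS X0 => t /= + _ => /(_ I) [] /eqP.
by rewrite expf_eq0/= => /eqP ->; rewrite expr0n.
Qed.

(** Clearing the denominator is legitimate even when it vanishes, by
    [moment_even_eq0]. *)
Lemma moment_growth (X : {RV P >-> R}) (r : R) : finite_moments P X ->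
  (fun k : nat => moment P X (2 * k.+1)%N / moment P X (2 * k)%N : R^o)
      =O_\oo (fun k : nat => k.+1%:R `^ r : R^o) ->
  exists C, 0 <= C /\ \forall k \near \oo,
    moment P X (2 * k.+1) <= C * k.+1%:R `^ r * moment P X (2 * k).
Proof.
move=> fX /eqO_exP [C C0 HC]; exists C; split; first exact: ltW.
apply: filterS HC => k.
rewrite ger0_norm ?divr_ge0 ?moment_even_ge0//.
rewrite (ger0_norm (powR_ge0 _ _)) => le_ratio.
have [m0|m0] := eqVneq (moment P X (2 * k)) 0.
  by rewrite (moment_even_eq0 fX m0) m0 mulr0.
by rewrite -ler_pdivrMr// lt_neqAle eq_sym m0 moment_even_ge0.
Qed.

End even_moments.

(** Both the law of [X] and a competitor with the same moments have even moments
    of factorial growth, hence exponential moments with the same exponent, to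
    which [probability_determined_by_moments] applies. *)
Lemma moment_determinate_of_growth d (T : measurableType d) {R : realType}
    (P : probability T R) (X : {RV P >-> R}) (C : R) :
  finite_moments P X ->
  (\forall k \near \oo,
     moment P X (2 * k.+1) <= C * k.+1%:R ^+ 2 * moment P X (2 * k)) ->
  moment_determinate P X.
Proof.
move=> fX [N _ growth]; split=> // nu fnu enu.
have [A [D [D0 XA]]] := factorial_bound_of_ratio (moment_even_ge0 P X) growth.
(* The law of X is taken on the same copy of the line as nu, which carries its
   own structure of measurable space. *)
have mX : measurable_fun [set: T] (X : T -> measurableTypeR R).
  by move=> _ B mB; exact: (@measurable_funPT _ _ _ _ X measurableT B mB).
pose Y : {mfun T >-> measurableTypeR R} :=
  @mfun_Sub _ _ T (measurableTypeR R) _ (mem_set mX).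
pose mu : probability (measurableTypeR R) R := distribution P Y.
have mexpn j :
    measurable_fun [set: measurableTypeR R] (fun x : R => (x ^+ j)%:E).
  suff mRexpn : measurable_fun [set: R] (fun x : R => (x ^+ j)%:E).
    by move=> mD B mB; exact: mRexpn mD B mB.
  by apply/measurable_EFinP; exact: measurable_funX.
have muE j : (\int[mu]_x (x ^+ j)%:E = (moment P X j)%:E)%E.
  rewrite -integral_expn_moment//; case: j => [|j].
    under eq_integral do rewrite expr0.
    under [RHS]eq_integral do rewrite expr0.
    by rewrite !integral_cst//= !probability_setT.
  apply: etrans (@integral_distribution _ _ T (measurableTypeR R) R P Y _
    (mexpn j.+1) _) _; first exact: fX.
  by [].
have nuE j : (\int[nu]_x (x ^+ j)%:E = (moment P X j)%:E)%E.
  have := integral_expn_moment j fnu => /= ->.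
  case: j => [|j]; last by rewrite enu.
  by rewrite !moment0.
move=> B mB; symmetry; rewrite -[LHS]/(mu B).
have rho0 : 0 < (D *+ 2)^-1 by rewrite invr_gt0 mulrn_wgt0.
apply: (probability_determined_by_moments _ rho0) mB.
- move=> j; split.
  + case: j => [|j]; first exact: finite_measure_integrable_cst.
    apply: (@integrable_pushforward _ _ T (measurableTypeR R) R Y mX P setT _
      (mexpn j.+1)) => //.
    by rewrite preimage_setT; exact: fX.
  + case: j => [|j]; first exact: finite_measure_integrable_cst.
    exact: fnu.
  + by rewrite muE nuE.
- apply: (@integrable_expR_even_moments _ _ _ mu id _ A D) => // k.
  by rewrite muE lee_fin.
- apply: (@integrable_expR_even_moments _ _ _ nu id _ A D) => // k.
  by rewrite nuE lee_fin.
Qed.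

(** * Moments of a product of independent variables *)

Section independent_product.
Context d (T : measurableType d) {R : realType} (P : probability T R).
Variables (I : finType) (X : I -> {RV P >-> R}).
Hypothesis indep : mutually_independent X.
Hypothesis fX : forall i, finite_moments P (X i).

Lemma measurable_prod_RV :
  measurable_fun [set: T] (fun t => \prod_i X i t).
Proof. by apply: measurable_prod => i _. Qed.

Let integral_norm_expn k i : (0 < k)%N ->
  (\int[P]_t (`|X i t| ^+ k)%:E)%E \is a fin_num.
Proof.
move=> k0; have := integrable_abse (fX i k0).
rewrite (_ : abse \o _ = fun t => (`|X i t| ^+ k)%:E).
  exact: integrable_fin_num.
by apply/funext => t; rewrite /= normrX.
Qed.

(** Independence is applied to the absolute values, whose powers are nonnegative
    for odd orders as well. *)
Lemma finite_moments_prod : finite_moments P (fun t => \prod_i X i t).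
Proof.
move=> k k0; apply/integrableP; split.
  apply/measurable_EFinP; apply: measurable_funX.
  exact: measurable_prod_RV.
rewrite (_ : (fun t => _) = fun t => (\prod_i `|X i t| ^+ k)%:E); last first.
  by apply/funext => t; rewrite /= normrX normr_prod prodrXl.
rewrite (expectation_prod (f := fun=> fun x => `|x| ^+ k) indep).
- rewrite ltey_eq; apply/orP; left.
  elim/big_ind: _ => // [x y|i _]; first exact: fin_numM.
  exact: integral_norm_expn.
- by move=> i; apply: measurable_funX; exact: normr_measurable.
- by move=> i x; rewrite exprn_ge0.
- by move=> i; exact: integral_norm_expn.
Qed.

Lemma moment_even_prod k :
  moment P (fun t => \prod_i X i t) (2 * k) = \prod_i moment P (X i) (2 * k).
Proof.
apply: EFin_inj; rewrite -(integral_expn_moment _ finite_moments_prod).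
transitivity (\int[P]_t (\prod_i (X i t) ^+ (2 * k))%:E)%E.
  by apply: eq_integral => t _; rewrite prodrXl.
rewrite (expectation_prod (f := fun=> fun x => x ^+ (2 * k)) indep).
- rewrite -prodEFin; apply: eq_bigr => i _; exact: integral_expn_moment.
- by move=> i; exact: measurable_funX.
- by move=> i x; rewrite exprn_even_ge0// oddM.
- by move=> i; rewrite integral_expn_moment.
Qed.

End independent_product.

Theorem theorem9 (d : measure_display) (T : measurableType d) (R : realType)
    (P : probability T R) (n : nat) (xi : 'I_n -> {RV P >-> R})
    (r : 'I_n -> R)
    (xi_indep : mutually_independent xi)
    (xi_moments : forall i, finite_moments P (xi i))
    (xi_growth : forall i,
      (fun k : nat =>
         moment P (xi i) (2 * k.+1)%N / moment P (xi i) (2 * k)%N : R^o)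
      =O_\oo (fun k : nat => k.+1%:R `^ r i : R^o))
    (r_le2 : \sum_(i < n) r i <= 2) :
  moment_determinate P (fun t => \prod_(i < n) xi i t).
Proof.
pose Z : {RV P >-> R} := mfun_Sub (mem_set (measurable_prod_RV xi)).
rewrite -[X in moment_determinate P X]/(Z : T -> R).
have fZ : finite_moments P Z := finite_moments_prod xi_indep xi_moments.
have [C HC] := choice (fun i => moment_growth (xi_moments i) (xi_growth i)).
apply: (@moment_determinate_of_growth _ _ _ _ Z (\prod_i C i) fZ).
have : \forall k \near \oo, forall i, moment P (xi i) (2 * k.+1) <=
    C i * k.+1%:R `^ r i * moment P (xi i) (2 * k).
  by apply: filter_forall => i; have [] := HC i.
apply: filterS => k Hk.
rewrite (moment_even_prod xi_indep xi_moments).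
rewrite (moment_even_prod xi_indep xi_moments).
apply: (@le_trans _ _
  (\prod_i (C i * k.+1%:R `^ r i * moment P (xi i) (2 * k)))).
  by apply: ler_prod => i _; rewrite moment_even_ge0 Hk.
rewrite !big_split /= ler_wpM2r//.
  by apply: prodr_ge0 => i _; exact: moment_even_ge0.
rewrite ler_wpM2l//; first by apply: prodr_ge0 => i _; have [] := HC i.
have -> : \prod_i k.+1%:R `^ r i = k.+1%:R `^ (\sum_i r i) :> R.
  apply/esym; apply: (big_morph (fun s => k.+1%:R `^ s)) => [x y|].
    by rewrite powRD// pnatr_eq0 implybT.
  exact: powRr0.
rewrite -powR_mulrn//; apply: ler_powR => //.
by rewrite ler1n.
Qed.
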